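(* Let $G$ be a connected Eulerian simple graph with an odd number of vertices. Then there exists an edge $e$ of $G$ such that $G-e$ is odd $2$-edge-colorable.
   Context: All graphs are finite and simple. A connected graph is Eulerian if every vertex has even degree. For a graph $H$, a subgraph is an odd subgraph if every vertex of it has odd degree in it. $H$ is odd $k$-edge-colorable if there is a map $c:E(H)\to\{1,\dots,k\}$ such that for each $i$ with $c^{-1}(i)\neq\emptyset$, the subgraph formed by the edge set $c^{-1}(i)$ (together with the endpoints of those edges) is an odd subgraph of $H$. $G-e$ denotes the graph obtained from $G$ by deleting the edge $e$ (keeping all vertices).
   Formalization: The graph G is additionally assumed to have more than one vertex, since the one-vertex graph is connected, Eulerian and of odd order but has no edge to delete. *)

(* Defs.v *)
From mathcomp Require Import all_boot.

Set Implicit Arguments.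
Unset Strict Implicit.
Unset Printing Implicit Defensive.

(* The vertex set is an explicit subset of the carrier T, so that a graph and
   its subgraphs (which may have fewer vertices) live in the same type. *)
Record sgraph (T : finType) := SGraph {
  vertices : {set T};
  edges : {set {set T}};
  edgesP : forall e, e \in edges -> (e \subset vertices) && (#|e| == 2)
}.

Section Graphs.
Variable T : finType.
Implicit Types (G H K : sgraph T) (e : {set T}) (v : T).

Definition adj G : rel T := fun x y => [set x; y] \in edges G.

Definition degree G v : nat := #|[set e in edges G | v \in e]|.

Definition connected G : Prop :=
  vertices G != set0 /\
  {in vertices G &, forall x y, connect (adj G) x y}.

Definition eulerian G : Prop :=
  connected G /\ {in vertices G, forall v, ~~ odd (degree G v)}.

Definition subgraph K H : bool :=
  (vertices K \subset vertices H) && (edges K \subset edges H).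

Definition odd_subgraph K H : Prop :=
  subgraph K H /\ {in vertices K, forall v, odd (degree K v)}.

Lemma del_edge_subproof G e f :
  f \in edges G :\ e -> (f \subset vertices G) && (#|f| == 2).
Proof. by case/setD1P=> _ /edgesP. Qed.

Definition del_edge G e : sgraph T := SGraph (@del_edge_subproof G e).

Lemma edge_subgraph_subproof G (P : pred {set T}) f :
  f \in [set e in edges G | P e] ->
  (f \subset cover [set e in edges G | P e]) && (#|f| == 2).
Proof.
move=> fP; rewrite (bigcup_sup f) //=.
by move: fP; rewrite inE => /andP[/edgesP/andP[]].
Qed.

Definition edge_subgraph G (P : pred {set T}) : sgraph T :=
  SGraph (@edge_subgraph_subproof G P).

(* Values of c outside edges H are irrelevant. *)
Definition odd_edge_colorable (k : nat) H : Prop :=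
  exists c : {set T} -> nat,
    {in edges H, forall e, 1 <= c e <= k} /\
    (forall i, 1 <= i <= k ->
       let Hi := edge_subgraph H (fun e => c e == i) in
       edges Hi != set0 -> odd_subgraph Hi H).

End Graphs.

(* Main.v *)
Require Import Defs.
From mathcomp Require Import all_boot.

(** Suppose that [uv] is an edge and that [S], the vertex set without [u] and
    [v], induces a connected subgraph.  The vertices of [S] not adjacent to [u]
    are then even in number, since [S] and the neighbourhood of [u] in [S] are
    both odd.  Hence there is a set [J] of edges inside [S] whose odd-degree
    vertices are exactly these.  Deleting [uv], give the first color to [J]
    and to the other edges at [u], and the second color to everything else:
    [u] sees only the first color, [v] only the second one, and every other
    vertex has odd degree in both.

    Such an edge exists because all degrees are at least [2]: take the first
    two vertices [u], [v] of a longest path.  The neighbours of [u] lie on the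
    path, so a component of [S] missing the path would be attached to [v] only;
    it would contain a neighbour [a] of [v] and a further neighbour [d] of [a],
    and replacing [u] by [d, a] would give a longer path. *)

Set Implicit Arguments.
Unset Strict Implicit.
Unset Printing Implicit Defensive.

(** * Longest paths and an edge whose ends do not separate the graph *)

Section LongestPath.
Variables (T : finType) (e : rel T).

Lemma exists_longest_path : exists s : seq T,
  [/\ uniq s, sorted e s &
      forall t, uniq t -> sorted e t -> size t <= size s].
Proof.
pose P k := [exists t : k.-tuple T, uniq t && sorted e t].
have P0 : exists k, P k by exists 0; apply/existsP; exists [tuple].
have Pb k : P k -> k <= #|T|.
  case/existsP=> t /andP[/card_uniqP tU _].
  by rewrite -(size_tuple t) -tU max_card.
case: (ex_maxnP P0 Pb) => k /existsP[t /andP[tU te]] kmax.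
exists t; split=> // t' tU' te'; rewrite size_tuple; apply: kmax.
by apply/existsP; exists (in_tuple t'); apply/andP.
Qed.

Definition avoid (u v : T) : rel T := fun a b =>
  [&& e a b, a \notin [:: u; v] & b \notin [:: u; v]].

Hypothesis e_sym : symmetric e.
Hypothesis e_irr : irreflexive e.
Hypothesis e_deg : forall x y, e x y -> exists2 z, z != y & e x z.

Lemma avoid_sym u v : symmetric (avoid u v).
Proof. by move=> a b; rewrite /avoid e_sym; congr (_ && _); rewrite andbC. Qed.

(** Since [e] lives on the whole carrier, the vertices that matter are those with a neighbour; [x'],
    [y'] and [w'] witness this. The root [z] is the third vertex of a longest path. *)
Lemma exists_nonseparating_edge x0 y0 : e x0 y0 ->
  (forall x y x' y', e x x' -> e y y' -> connect e x y) ->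
  exists u v z, e u v /\
    forall w w', e w w' -> w \notin [:: u; v] -> connect (avoid u v) w z.
Proof.
move=> e0 conn.
have [s [sU sP smax]] := exists_longest_path.
have s_ge2 : 1 < size s.
  apply: (smax [:: x0; y0]) => /=; last by rewrite e0.
  by rewrite inE andbT; apply: contraTneq e0 => ->; rewrite e_irr.
case: s s_ge2 sU sP smax => [|u [|v s]] // _ sU sP smax.
have euv : e u v by case/andP: sP.
have vP : path e v s by case/andP: sP.
have nbr_u a : e a u -> a \in u :: v :: s.
  move=> eau; apply: contraT => aN.
  suff: size [:: a, u, v & s] <= size [:: u, v & s] by rewrite ltnn.
  by apply: smax; [rewrite cons_uniq aN sU | rewrite /= eau euv vP].
(* A third vertex exists: [u] has a neighbour other than [v], and maximality puts it on the path. *)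
case: s sU sP vP smax nbr_u => [|z s] sU sP vP smax nbr_u.
  have [d dv eud] := e_deg euv.
  have := nbr_u d; rewrite e_sym eud => /(_ isT); rewrite !inE (negbTE dv) orbF.
  by move/eqP=> du; rewrite du e_irr in eud.
have evz : e v z by case/andP: vP.
have zs_avoid x : x \in z :: s -> x \notin [:: u; v].
  move=> xs; rewrite !inE negb_or; move: sU => /= /and3P[uN vN _].
  apply/andP; split; apply/eqP => xe; rewrite xe in xs.
    by rewrite inE xs orbT in uN.
  by rewrite xs in vN.
have zs_conn x : x \in z :: s -> connect (avoid u v) z x.
  have zP : path (avoid u v) z s.
    case/andP: vP => _; move: (z) (s) zs_avoid.
    move=> z1 s1; elim: s1 z1 => //= y s1 IH z1 av /andP[ezy ys].
    rewrite /avoid ezy !av ?mem_head ?inE ?eqxx ?orbT //=.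
    by apply: IH => // t ts; apply: av; rewrite inE ts orbT.
  exact: path_connect zP x.
exists u, v, z; split => //.
move=> w w' eww' wN; apply: contraT => wz.
(* Suppose that the component [C] of [w] misses [z]. It then misses the whole path, whose tail from
   [z] on is connected to [z]. *)
pose C := [pred x | connect (avoid u v) w x].
have C_avoid x : x \in C -> x \notin [:: u; v].
  rewrite inE => /connectP[p pP ->] {x}.
  elim: p w wN pP {eww' wz C} => //= y p IH x xN /andP[/and3P[_ _ yN]].
  exact: IH.
have C_path x : x \in C -> x \notin [:: u, v, z & s].
  move=> xC; rewrite -[_ :: _]/([:: u; v] ++ z :: s) mem_cat negb_or C_avoid //.
  apply/negP => /zs_conn zx.
  case/negP: wz; apply: connect_trans xC _.
  by rewrite (sym_connect_sym (@avoid_sym u v)).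
have C_step a b : a \in C -> e a b -> b \notin [:: u; v] -> b \in C.
  move=> aC eab bN; rewrite inE; apply: (connect_trans aC); apply: connect1.
  by rewrite /avoid eab bN C_avoid.
have C_not_u a : a \in C -> ~~ e a u.
  by move=> aC; apply/negP => /nbr_u; apply/negP/C_path.
have C_not_v a : a \in C -> ~~ e a v.
  move=> aC; apply/negP => eav.
  have [d dv ead] := e_deg eav.
  have du : d != u by apply: contraNneq (C_not_u _ aC) => <-.
  have dC : d \in C.
    by apply: C_step aC ead _; rewrite !inE negb_or du dv.
  suff: size [:: d, a, v, z & s] <= size [:: u, v, z & s] by rewrite ltnn.
  apply: smax; last by rewrite /= e_sym ead eav.
  have vs x : x \in C -> x \notin [:: v, z & s].
    by move/C_path; rewrite in_cons negb_or => /andP[].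
  have da : d != a by apply: contraTneq ead => ->; rewrite e_irr.
  have vU : uniq [:: v, z & s] by case/andP: sU.
  by rewrite 2!cons_uniq vU (vs a aC) in_cons negb_or da (vs d dC).
(* With no edge to [u] or [v], [C] would be closed in the whole graph, so connectedness would force
   [z] into it. *)
have C_closed : closed e C.
  apply: (intro_closed (sym_connect_sym e_sym)) => a b eab aC.
  apply: (C_step _ _ aC eab); rewrite !inE negb_or.
  apply/andP; split; apply/eqP => be; rewrite be in eab.
    by have := C_not_u _ aC; rewrite eab.
  by have := C_not_v _ aC; rewrite eab.
have wzC := closed_connect C_closed (conn w z w' v eww' (etrans (e_sym z v) evz)).
by move: wz; rewrite -[connect _ _ _]/(z \in C) -wzC inE connect0.
Qed.

End LongestPath.

(** * Edge sets modulo 2 and their odd-degree vertices *)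

Section Parity.
Variable T : finType.
Implicit Types (A B F : {set {set T}}) (G : sgraph T).

Definition symdiff (U : finType) (A B : {set U}) := (A :\: B) :|: (B :\: A).

Lemma in_symdiff (U : finType) (A B : {set U}) x :
  (x \in symdiff A B) = (x \in A) (+) (x \in B).
Proof. by rewrite !inE; case: (x \in A); case: (x \in B). Qed.

Lemma odd_card_symdiff (U : finType) (A B : {set U}) :
  odd #|symdiff A B| = odd #|A| (+) odd #|B|.
Proof.
have disj : (A :\: B) :&: (B :\: A) = set0.
  by apply/setP => x; rewrite !inE; case: (x \in A); rewrite ?andbF.
rewrite cardsU disj cards0 subn0 oddD -(cardsID B A) -(cardsID A B) setIC.
by rewrite !oddD; do 3!case: (odd _).
Qed.

(** As a function of [w], this is the boundary of [F] modulo 2; it is additive when [symdiff] is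
    taken as the sum of edge sets. *)
Definition parity F w : bool := odd #|[set f in F | w \in f]|.

Lemma parity_symdiff A B w :
  parity (symdiff A B) w = parity A w (+) parity B w.
Proof.
rewrite /parity -odd_card_symdiff; congr (odd #|pred_of_set _|).
by apply/setP => f; rewrite inE !in_symdiff !inE; case: (w \in f); rewrite ?andbF ?andbT.
Qed.

Lemma parity_edge (a b w : T) : a != b ->
  parity [set [set a; b]] w = (w == a) (+) (w == b).
Proof.
move=> ab; rewrite /parity.
have -> : [set f in [set [set a; b]] | w \in f]
        = if w \in [set a; b] then [set [set a; b]] else set0.
  apply/setP => f; rewrite inE in_set1; case: eqP => [->|fN] /=.
    by case: ifP => _; rewrite ?set11 ?inE.
  by case: ifP => _; rewrite ?inE //; symmetry; apply/eqP.
rewrite !inE; case: (eqVneq w a) => [->|_] /=; first by rewrite cards1 (negbTE ab).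
by case: (w == b); rewrite ?cards1 ?cards0.
Qed.

Lemma adj_sym G : symmetric (adj G).
Proof. by move=> x y; rewrite /adj setUC. Qed.

Lemma adj_irr G : irreflexive (adj G).
Proof.
move=> x; apply/negP => /edgesP/andP[_].
by rewrite setUid cards1.
Qed.

Lemma adj_vertex G x y : adj G x y -> x \in vertices G.
Proof. by case/edgesP/andP=> /subsetP/(_ x (set21 _ _)). Qed.

Lemma edge_pair G f x y :
  f \in edges G -> x \in f -> y \in f -> x != y -> f = [set x; y].
Proof.
move=> /edgesP/andP[_ /eqP f2] xf yf xy; apply/esym/eqP.
by rewrite eqEcard f2 cards2 xy subUset !sub1set xf yf.
Qed.

Lemma degree_adj G x : degree G x = #|[set y | adj G x y]|.
Proof.
have inj : {in [set y | adj G x y] &, injective (fun y => [set x; y])}.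
  move=> y z; rewrite !inE => xy xz yz.
  have : y \in [set x; z] by rewrite -yz set22.
  by rewrite !inE => /orP[] /eqP // yx; rewrite yx adj_irr in xy.
rewrite -(card_in_imset inj); congr #|pred_of_set _|.
apply/setP => f; rewrite inE; apply/andP/imsetP => [[fG xf]|[y]].
  have /andP[_ /cards2P[a [b [ab fab]]]] := edgesP fG.
  have [y yf yx] : exists2 y, y \in f & x != y.
    case: (eqVneq x a) => [->|xa]; first by exists b; rewrite // fab set22.
    by exists a; rewrite // fab set21.
  exists y; last exact: edge_pair fG xf yf yx.
  by rewrite inE /adj -(edge_pair fG xf yf yx).
by rewrite inE => xy ->; rewrite set21.
Qed.

(** Existence of a T-join: sum modulo 2 the edge sets of walks from each point of [X] to the root
    [z]. Each walk contributes its two ends, so [z] receives the extra term [odd #|X|]. *)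
Lemma parity_join (r : rel T) (E : {set {set T}}) z (X : {set T}) :
  (forall a b, r a b -> (a != b) && ([set a; b] \in E)) ->
  {in X, forall x, connect r x z} ->
  exists2 J : {set {set T}}, J \subset E &
    forall w, parity J w = (w \in X) (+) (odd #|X| && (w == z)).
Proof.
move=> rE.
(* The boundaries of the successive edges telescope. The walk may repeat edges, since [symdiff]
   cancels them in pairs. *)
have pair x : connect r x z -> exists2 J : {set {set T}}, J \subset E &
    forall w, parity J w = (w == x) (+) (w == z).
  case/connectP=> p; elim: p x => [|y p IH] x /=.
    move=> _ ->; exists set0; first exact: sub0set.
    move=> w; rewrite addbb /parity; rewrite (_ : [set f in _ | _] = set0) ?cards0 //.
    by apply/setP => f; rewrite !inE.
  case/andP=> /rE/andP[xy xyE] yp /(IH _ yp)[J JE Jp].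
  exists (symdiff [set [set x; y]] J).
    apply/subsetP => f; rewrite in_symdiff in_set1.
    case: eqP => [-> //|_] /=; exact: (subsetP JE).
  by move=> w; rewrite parity_symdiff Jp parity_edge // addbA addbK.
move: {2}#|X| (erefl #|X|) => n; elim: n X => [|n IH] X.
  move/eqP; rewrite cards_eq0 => /eqP -> _; exists set0; first exact: sub0set.
  move=> w; rewrite cards0 inE /parity (_ : [set f in _ | _] = set0) ?cards0 //.
  by apply/setP => f; rewrite !inE.
move=> Xn Xz; have /set0Pn[x xX] : X != set0 by rewrite -cards_eq0 Xn.
have Xx : #|X :\ x| = n by apply/eqP; rewrite -eqSS -Xn (cardsD1 x X) xX.
have [||J JE Jp] := IH (X :\ x) => // [y /setD1P[_ /Xz] //|].
have [K KE Kp] := pair x (Xz x xX).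
exists (symdiff J K).
  apply/subsetP => f; rewrite in_symdiff.
  case fJ: (f \in J) => /=; last exact: (subsetP KE).
  by rewrite (subsetP JE).
move=> w; rewrite parity_symdiff Jp Kp Xx Xn !inE /=.
case: (eqVneq w x) => [->|_]; rewrite ?xX /=;
  by case: (_ \in X); case: (odd n); case: (_ == z).
Qed.

End Parity.

(** * Choice of the edge and the two color classes *)

Theorem theorem1p9 (T : finType) (G : sgraph T)
    (G_eulerian : eulerian G)
    (G_odd_order : odd #|vertices G|)
    (G_nontrivial : 1 < #|vertices G|) :
  exists2 e : {set T}, e \in edges G & odd_edge_colorable 2 (del_edge G e).
Proof.
have [[_ conn] even] := G_eulerian.
(* An even number of neighbours, less [y], is odd and hence nonzero. *)
have deg2 x y : adj G x y -> exists2 z, z != y & adj G x z.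
  move=> xy; have := even x (adj_vertex xy).
  rewrite degree_adj (cardsD1 y) inE xy /= negbK => oddN.
  have /set0Pn[z] : [set y | adj G x y] :\ y != set0.
    by apply: contraTneq oddN => ->; rewrite cards0.
  by rewrite !inE => /andP[zy xz]; exists z.
have has_nbr x : x \in vertices G -> exists y, adj G x y.
  move=> xG; have [y yG yx] : exists2 y, y \in vertices G & y != x.
    move: G_nontrivial; rewrite (cardsD1 x) xG ltnS card_gt0.
    by case/set0Pn=> y /setD1P[]; exists y.
  case/connectP: (conn x y xG yG) => [[|y' p]] /=.
    by move=> _ yx'; rewrite yx' eqxx in yx.
  by case/andP=> xy' _ _; exists y'.
have [x0 [y0 xy0]] : exists x y, adj G x y.
  have /card_gt0P[x /has_nbr[y xy]] := ltnW G_nontrivial.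
  by exists x, y.
have conn' x y x' y' : adj G x x' -> adj G y y' -> connect (adj G) x y.
  by move=> /adj_vertex xG /adj_vertex yG; apply: conn.
have [u [v [z [uv avoidz]]]] :=
  exists_nonseparating_edge (@adj_sym _ G) (@adj_irr _ G) deg2 xy0 conn'.
have vu : adj G v u by rewrite adj_sym.
have neq_uv : u != v by apply: contraTneq uv => ->; rewrite adj_irr.
have uG := adj_vertex uv; have vG := adj_vertex vu.
pose S := vertices G :\: [set u; v].
pose X := [set w in S | ~~ adj G u w].
have evenX : ~~ odd #|X|.
  have cS : #|vertices G| = (#|S|).+2.
    rewrite (cardsD1 u) (cardsD1 v (_ :\ _)) !inE uG vG eq_sym neq_uv /=.
    by rewrite /S setDDl.
  have cN : #|[set y | adj G u y]| = (#|S :&: [set y | adj G u y]|).+1.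
    rewrite (cardsD1 v) inE uv; congr (_.+1); apply: eq_card => w.
    rewrite !inE negb_or; case uw: (adj G u w); rewrite ?andbF //= !andbT.
    have -> : w \in vertices G by apply: (@adj_vertex _ G w u); rewrite adj_sym.
    rewrite andbT (_ : w != u) //.
    by apply: contraTneq uw => ->; rewrite adj_irr.
  have cX : X = S :\: [set y | adj G u y].
    by apply/setP => w; rewrite !inE andbC.
  move: G_odd_order (even u uG).
  rewrite cS degree_adj cN -(cardsID [set y | adj G u y] S) -cX /= !negbK oddD.
  by move=> + oN; rewrite oN; case: (odd #|X|).
pose E' := [set f in edges G | (u \notin f) && (v \notin f)].
have [||J /subsetP JE Jp] := @parity_join T (avoid (adj G) u v) E' z X.
- move=> a b /and3P[ab]; rewrite !inE !negb_or => /andP[au av] /andP[bu bv].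
  rewrite [_ \in edges G]ab !(eq_sym u) !(eq_sym v) au av bu bv !andbT.
  by apply: contraTneq ab => ->; rewrite adj_irr.
- move=> x; rewrite !inE -andbA => /and3P[xN xG _].
  by have [x' xx'] := has_nbr x xG; apply: avoidz xx' _; rewrite !inE.
(* As [X] is even, no correction at the root [z] remains. *)
have {}Jp w : parity J w = (w \in X) by rewrite Jp (negbTE evenX) addbF.
pose e := [set u; v]; pose H := del_edge G e.
exists e => //.
pose star := [set f in edges H | u \in f].
(* The first color class. No edge of [J] meets [u], so this is a disjoint union; as a [symdiff] it
   has additive parity. *)
pose A := symdiff J star.
have JG f : f \in J -> [/\ f \in edges G, u \notin f & v \notin f].
  by move/JE; rewrite inE => /and3P.
have JH f : f \in J -> f \in edges H.
  move=> /JG[fG uf _]; rewrite !inE fG andbT.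
  by apply: contraNneq uf => ->; rewrite set21.
have AE f : (f \in A) = (f \in J) || (f \in edges H) && (u \in f).
  rewrite in_symdiff inE; case fJ: (f \in J) => //.
  by have [_ /negbTE -> _] := JG f fJ; rewrite andbF.
have AH f : f \in A -> f \in edges H.
  by rewrite AE => /orP[/JH|/andP[]].
have vA f : f \in A -> v \notin f.
  rewrite AE => /orP[/JG[]|/andP[]] //.
  rewrite !inE => /andP[fe fG] uf; apply: contra fe => vf.
  by rewrite (edge_pair fG uf vf neq_uv).
have parH w : w \in vertices G -> parity (edges H) w = (w \in e).
  move=> wG; have -> : edges H = symdiff (edges G) [set e].
    apply/setP => f; rewrite in_symdiff !inE.
    by case: eqP => [->|]; rewrite ?[e \in _]uv ?addbF.
  rewrite parity_symdiff parity_edge // {1}/parity (negbTE (even w wG)) !inE.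
  by case: (eqVneq w u) => [->|_]; rewrite ?(negbTE neq_uv).
(* At [u] only [star] counts, and [u] has odd degree in [H]. At a vertex of [S] exactly one of [J]
   and [star] contributes an odd degree, according to adjacency with [u]. At [v] neither has an
   edge. *)
have parA w : w \in vertices G -> parity A w = (w != v).
  move=> wG; rewrite parity_symdiff Jp.
  case: (eqVneq w u) => [->|wu].
    rewrite neq_uv !inE eqxx /=; transitivity (parity (edges H) u).
      congr (odd #|pred_of_set _|).
      by apply/setP => f; rewrite !inE; case: (u \in f); rewrite ?andbF ?andbT.
    by rewrite parH // !inE eqxx.
  have -> : parity star w = (w != v) && adj G u w.
    rewrite /parity; set B := [set f in star | _].
    have -> : B = if (w != v) && adj G u w then [set [set u; w]] else set0.
      apply/setP => f; rewrite /B !inE; apply/idP/idP.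
        case/andP=> /andP[/andP[fe fG] uf] wf.
        have fuw := edge_pair fG uf wf (_ : u != w).
        rewrite eq_sym in fuw; rewrite fuw // in fe fG *.
        rewrite /adj fG andbT (_ : w != v) ?set11 //.
        by apply: contraNneq fe => ->.
      case: ifP; last by rewrite inE.
      case/andP=> wv uw /set1P ->; rewrite [_ \in edges G]uw set21 set22 !andbT.
      apply: contraNneq wv => uwe.
      have : w \in e by rewrite -uwe set22.
      by rewrite !inE (negbTE wu).
    by case: ifP; rewrite ?cards1 ?cards0.
  rewrite !inE wG (negbTE wu) /= andbT.
  by case: (w == v); case: (adj G u w).
pose c f := if f \in A then 1 else 2.
exists c; split; first by move=> f _; rewrite /c; case: ifP.
have cover_sub (P : pred {set T}) w :
    w \in vertices (edge_subgraph H P) ->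
    w \in vertices G /\ exists f, [/\ f \in edges H, P f & w \in f].
  case/bigcupP=> f; rewrite inE => /andP[fH Pf] wf; split; last by exists f.
  by have /andP[/subsetP/(_ w wf)] := edgesP fH.
move=> i i12 Hi _; split.
  apply/andP; split; apply/subsetP; first by move=> w /cover_sub[].
  by move=> f; rewrite inE => /andP[].
move=> w /cover_sub[wG [f [fH /eqP cf wf]]].
(* Each class has odd degree at all vertices of [G] but one: [v] for the first color, [u] for the
   second. That vertex meets no edge of the class, so it differs from [w], which lies on [f]. *)
rewrite -[odd _]/(parity (edges Hi) w).
have [i1|i2] : i = 1 \/ i = 2 by case: i i12 {Hi cf} => [|[|[|]]] // _; [left|right].
- have -> : edges Hi = A.
    apply/setP => g; rewrite inE i1 /c; case gA: (g \in A); rewrite ?andbF //.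
    by rewrite AH.
  rewrite parA //; apply: contraTneq wf => ->; apply: vA.
  by move: cf; rewrite i1 /c; case: ifP.
- have -> : edges Hi = symdiff (edges H) A.
    apply/setP => g; rewrite in_symdiff inE i2 /c.
    case gA: (g \in A); last by rewrite addbF andbT.
    by rewrite AH.
  rewrite parity_symdiff parH // parA // !inE.
  have wu : w != u.
    apply: contraTneq wf => ->; move: cf; rewrite i2 /c AE fH.
    by case: (u \in f); rewrite ?orbT.
  by rewrite (negbTE wu); case: (w == v).
Qed.
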